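(* For $0\le\ell\le n$ let $M_{n,\ell}$ be the $n\times n$ matrix whose first $n-\ell$ diagonal entries equal $s+t$ and all of whose other entries equal $t$, and let $P_{n,\ell}(s,t)=\operatorname{per}(M_{n,\ell})$, with $P_{0,0}=1$. Then for $0\le\ell\le n$: (1) $\displaystyle P_{n,\ell}(s,t)=h_{n-\ell,\ell}(s,t)=\sum_{j=\ell}^{n}\binom{n-\ell}{n-j}\,j!\,s^{n-j}t^{j}$; (2) $\displaystyle P_{n,\ell}(s,t)=\sum_{j=0}^{\ell}\binom{\ell}{j}(-1)^j s^j\,P_{n-j,0}(s,t)$; (3) $\displaystyle s^n=\sum_{\ell=0}^{n}\binom{n}{\ell}(-1)^{\ell}\,P_{n,\ell}(s,t)$.
   Context: $\operatorname{per}$ denotes the permanent and $s,t$ are scalars (or indeterminates). $h_{a,b}(x,t)=\int_0^\infty (x+ty)^a(ty)^b e^{-y}\,dy=\sum_{j=0}^a\binom aj (b+j)!\,x^{a-j}t^{b+j}$. *)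

(* Defs.v *)
From HB Require Import structures.
From mathcomp Require Import all_boot all_order all_algebra all_fingroup.
From mathcomp Require Import all_classical all_reals all_analysis.
From mathcomp Require Import complex.

Set Implicit Arguments.
Unset Strict Implicit.
Unset Printing Implicit Defensive.

Import Order.TTheory GRing.Theory Num.Theory.
Local Open Scope ring_scope.

Definition per (A : comPzRingType) (n : nat) (M : 'M[A]_n) : A :=
  \sum_(sigma : 'S_n) \prod_(i < n) M i (sigma i).

Definition Mmx (A : comPzRingType) (n l : nat) (s t : A) : 'M[A]_n :=
  \matrix_(i < n, j < n) (if (i == j) && (i < n - l)%N then s + t else t).

Definition P (A : comPzRingType) (n l : nat) (s t : A) : A :=
  per (Mmx n l s t).

(* The convention for the empty permanent. *)
Lemma P00 (A : comPzRingType) (s t : A) : P 0 0 s t = 1.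
Proof.
rewrite /P /per (eq_bigr (fun=> 1)) => [|sigma _]; last by rewrite big_ord0.
by rewrite sumr_const card_Sn.
Qed.

(* h_{a,b}(x,t) in its closed form, which makes sense over any commutative
   ring and in particular for indeterminates x, t. *)
Definition h (A : comPzRingType) (a b : nat) (x t : A) : A :=
  \sum_(0 <= j < a.+1)
    ('C(a, j) * (b + j)`!)%:R * x ^+ (a - j) * t ^+ (b + j).

(* Lebesgue integrals of complex-valued functions of a real variable, taken
   componentwise. Rintegral is total, so integrability has to be asserted
   separately. *)
Definition cintegrable (K : realType) (D : set K) (f : K -> K[i]) : Prop :=
  integrable (@lebesgue_measure K) D (fun y => (complex.Re (f y))%:E) /\
  integrable (@lebesgue_measure K) D (fun y => (complex.Im (f y))%:E).

Definition cintegral (K : realType) (D : set K) (f : K -> K[i]) : K[i] :=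
  Complex (Rintegral (@lebesgue_measure K) D (fun y => complex.Re (f y)))
          (Rintegral (@lebesgue_measure K) D (fun y => complex.Im (f y))).

Definition h_integrand (K : realType) (a b : nat) (x t : K[i]) (y : K) : K[i] :=
  (x + t * real_complex K y) ^+ a * (t * real_complex K y) ^+ b
  * real_complex K (expR (- y)).

Definition h_int (K : realType) (a b : nat) (x t : K[i]) : K[i] :=
  cintegral `[0, +oo[%classic (h_integrand a b x t).

(* Main.v *)
Require Import Defs.
From HB Require Import structures.
From mathcomp Require Import all_boot all_order all_algebra all_fingroup.
From mathcomp Require Import all_classical all_reals all_analysis.
From mathcomp Require Import measurable_realfun complex.
From mathcomp Require Import ring.

(* Choosing s or t in each of the first n - l diagonal entries s + t turns the
   permanent into a sum over subsets J of these diagonal positions: J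
   contributes s^|J| t^(n-|J|) times the number (n-|J|)! of permutations fixing
   J pointwise. This is h_{n-l,l}(s,t). Formally h_{a,b} = L((s+tY)^a (tY)^b)
   with L the linear functional Y^k |-> k!, that is, integration against e^{-Y}.
   The identity (s+tY)^a (tY)^(b+1) = (s+tY)^(a+1) (tY)^b - s (s+tY)^a (tY)^b
   gives h_{a,b+1} = h_{a+1,b} - s h_{a,b}. Iterating it, either by lowering b to
   0 or by solving for s^n h_{0,0} = s^n, gives the two alternating sums. *)

Set Implicit Arguments.
Unset Strict Implicit.
Unset Printing Implicit Defensive.

Import Order.TTheory GRing.Theory Num.Theory.
Local Open Scope ring_scope.

(** * Counting subsets by size and permutations with prescribed fixed points *)

Lemma sum_subset_card (V : nmodType) (I : finType) (D : {set I}) (F : nat -> V) :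
  \sum_(J : {set I} | J \subset D) F #|J| =
  \sum_(0 <= k < #|D|.+1) F k *+ 'C(#|D|, k).
Proof.
rewrite big_mkord.
(* Group the subsets by cardinality. [inord] loses nothing here, since J inside D forces
   [#|J| <= #|D|]. *)
rewrite (@partition_big _ _ _ _ _ _ _
  (fun J : {set I} => inord #|J| : 'I_#|D|.+1) xpredT) //=.
apply: eq_bigr => k _.
have cardE (J : {set I}) : (J \subset D) && (inord #|J| == k) =
    (J \in [set J' : {set I} | J' \subset D & #|J'| == k :> nat])%SET.
  rewrite inE; case: (boolP (J \subset D)) => //= /subset_leq_card leJD.
  by rewrite -val_eqE /= inordK.
rewrite (eq_bigl _ _ cardE) (eq_bigr (fun=> F k)) => [|J]; last first.
  by rewrite inE => /andP[_ /eqP ->].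
by rewrite sumr_const cards_draws.
Qed.

(** A permutation fixes J pointwise exactly when its support lies in the complement of J, and
    [card_perm] counts those. *)
Lemma card_perm_fixing (I : finType) (J : {set I}) :
  #|[set sigma : {perm I} | [forall i in J, sigma i == i]]| = (#|I| - #|J|)`!.
Proof.
have -> : (#|I| - #|J|)%N = #|~: J| by rewrite [RHS]cardsCs finset.setCK.
rewrite -card_perm; apply: eq_card => sigma; rewrite inE.
apply/forall_inP/fintype.subsetP => [fixJ i|supp i iJ].
  by rewrite !inE; apply: contraNN => /fixJ.
by apply: contraTT iJ => /supp; rewrite inE.
Qed.

Lemma card_ord_lt n m : (m <= n)%N -> #|[set i : 'I_n | (i < m)%N]| = m.
Proof.
move=> lemn; rewrite -sum1_card (eq_bigl (fun i : 'I_n => (i < m)%N)).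
  by rewrite -(big_ord_widen _ (fun=> 1%N) lemn) sum1_card card_ord.
by move=> i; rewrite inE.
Qed.

(** * Expansion of the permanent over an arbitrary commutative ring *)

Section Algebra.
Variable A : comPzRingType.
Implicit Types s t : A.

Lemma P_sum_subset n l s t :
  P n l s t =
  \sum_(J : {set 'I_n} | J \subset [set i : 'I_n | (i < n - l)%N])
    (s ^+ #|J| * t ^+ (n - #|J|)) *+ (n - #|J|)`!.
Proof.
rewrite /P /per; set D := [set i : 'I_n | _].
pose fixed (sigma : 'S_n) (J : {set 'I_n}) :=
  (J \subset D) && [forall i in J, sigma i == i].
(* Each product over [sigma] expands into the subsets of [D] that [sigma] fixes pointwise.
   Exchanging the two sums leaves, for each J, the number of permutations fixing J. *)
transitivity (\sum_(sigma : 'S_n) \sum_(J : {set 'I_n} | fixed sigma J)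
   s ^+ #|J| * t ^+ (n - #|J|)); last first.
  rewrite (exchange_big_dep (fun J : {set 'I_n} => J \subset D)) /=; last first.
    by move=> sigma J _ /andP[].
  apply: eq_bigr => J JD; rewrite sumr_const.
  have := card_perm_fixing J; rewrite card_ord => <-.
  by congr (_ *+ _); apply: eq_card => sigma; rewrite !inE unfold_in /fixed JD.
apply: eq_bigr => sigma _.
(* Read as 0 or 1, [c i] says whether [sigma] meets an entry s + t in row i, so every factor is
   [s *+ c i + t]. *)
pose c i := (i \in D) && (sigma i == i).
rewrite (eq_bigr (fun i => s *+ c i + t)) => [|i _]; last first.
  by rewrite mxE /c inE andbC eq_sym; case: ifP => _; rewrite ?add0r.
(* J is the set of rows where the summand [s *+ c i] is chosen; the term vanishes as soon as [c i]
   fails for some i in J. *)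
rewrite bigA_distr [RHS]big_mkcond; apply: eq_big => // J _.
rewrite (bigID (mem J)) /=.
rewrite [X in _ * X = _](eq_bigr (fun=> t)) => [|i /negbTE -> //].
rewrite (eq_bigr (fun i => s *+ c i)) => [|i -> //].
have -> : \prod_(i | i \notin J) t = t ^+ (n - #|J|).
  have -> : (n - #|J|)%N = #|~: J| by rewrite [RHS]cardsCs finset.setCK card_ord.
  by rewrite -prodr_const; apply: eq_bigl => i; rewrite inE.
have -> : fixed sigma J = [forall i in J, c i].
  apply/andP/forall_inP => [[/fintype.subsetP JD /forall_inP fJ] i iJ|cJ].
    by rewrite /c JD ?fJ.
  by split; [apply/fintype.subsetP|apply/forall_inP] => i /cJ /andP[].
case: (boolP [forall i in J, c i]) => [/forall_inP cJ|].
  by rewrite (eq_bigr (fun=> s)) ?prodr_const // => i /cJ ->.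
rewrite negb_forall_in => /exists_inP[i iJ /negbTE ci].
by rewrite (bigD1 i) //= ci !mul0r.
Qed.

Lemma h_shifted n l s t : (l <= n)%N ->
  h (n - l) l s t =
  \sum_(l <= j < n.+1) ('C(n - l, n - j) * j`!)%:R * s ^+ (n - j) * t ^+ j.
Proof.
move=> leln; rewrite /h -{1}[in RHS](add0n l) big_addn subSn //.
apply: eq_big_nat => j /andP[_ ltj].
have -> : (n - (j + l) = n - l - j)%N by rewrite addnC subnDA.
by rewrite addnC bin_sub.
Qed.

Lemma P_h n l s t : (l <= n)%N -> P n l s t = h (n - l) l s t.
Proof.
move=> leln; rewrite P_sum_subset.
rewrite (sum_subset_card _ (fun k => (s ^+ k * t ^+ (n - k)) *+ (n - k)`!)).
(* The index of [h] counts the diagonal positions where t is chosen, so it equals n - l - |J| and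
   the sum has to be reversed. *)
rewrite card_ord_lt ?leq_subr // /h big_nat_rev /= add0n.
apply: eq_big_nat => j /andP[_]; rewrite ltnS => lej.
rewrite subSS bin_sub // -mulrnA mulnC -[LHS]mulr_natl mulrA.
suff -> : (n - (n - l - j) = l + j)%N by [].
by rewrite -subnDA subKn // -(subnKC leln) leq_add2l.
Qed.

(** Pascal's rule inside a sum; it drives the recurrence for [h] and both inductions on it. *)
Lemma sum_pascal (F : nat -> A) n :
  \sum_(0 <= j < n.+2) 'C(n.+1, j)%:R * F j =
  \sum_(0 <= j < n.+1) 'C(n, j)%:R * F j +
  \sum_(0 <= j < n.+1) 'C(n, j)%:R * F j.+1.
Proof.
rewrite big_nat_recl // (eq_big_nat _ _ (F2 := fun j =>
  'C(n, j.+1)%:R * F j.+1 + 'C(n, j)%:R * F j.+1)) => [|j _]; last first.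
  by rewrite binS natrD mulrDl.
rewrite big_split /= addrA; congr (_ + _).
rewrite big_nat_recr //= (bin_small (ltnSn n)) mul0r addr0.
by rewrite [RHS]big_nat_recl // !bin0.
Qed.

Lemma h_recurrence s t a b : h a b.+1 s t = h a.+1 b s t - s * h a b s t.
Proof.
have hE c d : h c d s t = \sum_(0 <= j < c.+1)
    'C(c, j)%:R * (((d + j)`!)%:R * s ^+ (c - j) * t ^+ (d + j)).
  by apply: eq_bigr => j _; rewrite natrM !mulrA.
rewrite !hE sum_pascal.
(* The factor s turns a - j into a + 1 - j, so s h_{a,b} is the unshifted Pascal sum of h_{a+1,b};
   the shifted one is h_{a,b+1}. *)
have <- : \sum_(0 <= j < a.+1) 'C(a, j)%:R *
    (((b + j)`!)%:R * s ^+ (a.+1 - j) * t ^+ (b + j)) =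
    s * \sum_(0 <= j < a.+1) 'C(a, j)%:R *
    (((b + j)`!)%:R * s ^+ (a - j) * t ^+ (b + j)).
  rewrite mulr_sumr; apply: eq_big_nat => j; rewrite ltnS => lej.
  by rewrite subSn // exprS; ring.
rewrite addrAC subrr add0r.
by apply: eq_bigr => j _; rewrite addnS addSn subSS.
Qed.

(** * Solving the two-index recurrence *)

Section Recurrence.
Variables (s : A) (f : nat -> nat -> A).
Hypothesis f_rec : forall a b, f a b.+1 = f a.+1 b - s * f a b.

(** With U and V the shifts of the first and second index, the hypothesis reads V = U - s; this is
    the binomial expansion of V^b. *)
Lemma rec_expand b a :
  f a b = \sum_(0 <= j < b.+1) 'C(b, j)%:R * (-1) ^+ j * s ^+ j * f (a + b - j) 0.
Proof.
pose F a b j := (-1) ^+ j * s ^+ j * f (a + b - j) 0.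
suff -> : f a b = \sum_(0 <= j < b.+1) 'C(b, j)%:R * F a b j.
  by apply: eq_bigr => j _; rewrite /F !mulrA.
elim: b a => [|b IH] a; first by rewrite big_nat1 /F addn0 subn0 bin0 !mul1r.
rewrite f_rec !IH sum_pascal mulr_sumr -sumrN; congr (_ + _).
  by apply: eq_bigr => j _; rewrite /F addSnnS.
by apply: eq_bigr => j _; rewrite /F addnS subSS !exprS; ring.
Qed.

(** In terms of the commuting index shifts U and V, s = U - V, and this is the binomial expansion of
    s^m. *)
Lemma rec_invert m a b :
  s ^+ m * f a b =
  \sum_(0 <= k < m.+1) 'C(m, k)%:R * (-1) ^+ k * f (a + m - k) (b + k).
Proof.
pose F a b m k := (-1) ^+ k * f (a + m - k) (b + k).
suff -> : s ^+ m * f a b = \sum_(0 <= k < m.+1) 'C(m, k)%:R * F a b m k.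
  by apply: eq_bigr => k _; rewrite /F !mulrA.
elim: m a b => [|m IH] a b.
  by rewrite big_nat1 /F !addn0 subn0 bin0 !mul1r.
have -> : s ^+ m.+1 * f a b = s ^+ m * f a.+1 b - s ^+ m * f a b.+1.
  by rewrite f_rec exprS; ring.
rewrite !IH sum_pascal -sumrN; congr (_ + _).
  by apply: eq_bigr => k _; rewrite /F addSnnS.
by apply: eq_bigr => k _; rewrite /F addnS subSS addSnnS exprS; ring.
Qed.

End Recurrence.

Lemma P_inclusion_exclusion n l s t : (l <= n)%N ->
  P n l s t =
  \sum_(0 <= j < l.+1) 'C(l, j)%:R * (-1) ^+ j * s ^+ j * P (n - j) 0 s t.
Proof.
move=> leln; rewrite P_h //.
rewrite (rec_expand (s := s) (f := fun a b => h a b s t)); last first.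
  exact: h_recurrence.
by rewrite subnK //; apply: eq_bigr => j _; rewrite P_h // subn0.
Qed.

Lemma expr_sum_P n s t :
  s ^+ n = \sum_(0 <= k < n.+1) 'C(n, k)%:R * (-1) ^+ k * P n k s t.
Proof.
have h00 : h 0 0 s t = 1 by rewrite /h big_nat1 !mul1r.
rewrite -[LHS]mulr1 -[X in _ * X = _]h00.
rewrite (rec_invert (s := s) (f := fun a b => h a b s t)); last first.
  exact: h_recurrence.
by apply: eq_big_nat => k /andP[_ lek]; rewrite P_h.
Qed.

End Algebra.

(** * The integral of y^n e^{-y} over the half-line *)

Section GammaIntegral.
Import numFieldNormedType.Exports.
Local Open Scope classical_set_scope.
Variable K : realType.
Local Notation mu := (@lebesgue_measure K).
Local Notation halfline := (`[0, +oo[%classic : set K).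

Definition gamma_fun (n : nat) (y : K) : K := y ^+ n * expR (- y).

(** The antiderivative of [gamma_fun n] obtained by repeated integration by parts. *)
Fixpoint gamma_primitive (n : nat) (y : K) : K :=
  if n is m.+1 then n%:R * gamma_primitive m y - gamma_fun n y
  else - gamma_fun 0 y.

Lemma gamma_primitive0 n : gamma_primitive n 0 = - n`!%:R.
Proof.
elim: n => [|n IH] /=; first by rewrite /gamma_fun oppr0 expR0 mulr1.
by rewrite IH /gamma_fun expr0n mul0r subr0 mulrN -natrM.
Qed.

Lemma is_derive_expRN (y : K) : is_derive y 1 (fun z => expR (- z)) (- expR (- y)).
Proof.
have -> : - expR (- y) = expR (- y) * -1 by rewrite mulrN1.
have dexp := is_derive_expR (- y).
exact: (@is_derive1_comp _ expR -%R).
Qed.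

Lemma is_derive_gamma_fun n (y : K) :
  is_derive y 1 (gamma_fun n.+1) (n.+1%:R * gamma_fun n y - gamma_fun n.+1 y).
Proof.
have dexp := is_derive_expRN y.
have dpow : is_derive y 1 (fun z : K => z ^+ n.+1) (n.+1%:R * y ^+ n).
  apply: DeriveDef; first exact: exprn_derivable.
  by rewrite exp_derive /GRing.scale /= mulr1.
apply: is_derive_eq (is_deriveM dpow dexp) _.
by rewrite /GRing.scale /= /gamma_fun exprS; ring.
Qed.

Lemma is_derive_gamma_primitive n (y : K) :
  is_derive y 1 (gamma_primitive n) (gamma_fun n y).
Proof.
elim: n => [|n IH].
  have dexp := is_derive_expRN y.
  have -> : gamma_primitive 0 = (fun z => - expR (- z)).
    by apply/funext => z; rewrite /= /gamma_fun mul1r.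
  by apply: is_derive_eq; rewrite /gamma_fun mul1r opprK.
have dgamma := is_derive_gamma_fun n y.
apply: is_derive_eq; rewrite /GRing.scale /=; ring.
Qed.

Lemma gamma_fun_ge0 n y : 0 <= y -> 0 <= gamma_fun n y.
Proof. by move=> y_ge0; rewrite mulr_ge0 ?exprn_ge0 ?expR_ge0. Qed.

Lemma gamma_fun_cvg0 n : gamma_fun n y @[y --> +oo] --> (0 : K).
Proof.
(* The upper bound (n+1)!/y comes from e^y >= 1 + y^(n+1)/(n+1)!. *)
apply: (@squeeze_cvgr _ _ _ _ (fun=> 0) (fun y => n.+1`!%:R * y^-1)).
- near=> y.
  have y_gt0 : 0 < y by near: y; exact: nbhs_pinfty_gt.
  rewrite gamma_fun_ge0 ?(ltW y_gt0) //= /gamma_fun expRN.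
  rewrite ler_pdivrMr ?expR_gt0 // mulrAC ler_pdivlMr // -exprSr.
  rewrite -ler_pdivrMl ?ltr0n ?fact_gt0 // mulrC.
  by apply: le_trans (expR_ge1Dxn n (ltW y_gt0)); rewrite lerDr.
- exact: cvg_cst.
- rewrite -[X in _ --> X](mulr0 n.+1`!%:R); apply: cvgM; first exact: cvg_cst.
  by apply/gtr0_cvgV0; [exact: nbhs_pinfty_gt|exact: cvg_id].
Unshelve. all: by end_near. Qed.

Lemma gamma_primitive_cvg0 n : gamma_primitive n y @[y --> +oo] --> (0 : K).
Proof.
elim: n => [|n IH] /=.
  by rewrite -oppr0; apply: cvgN; exact: gamma_fun_cvg0.
rewrite -[X in _ --> X](subr0 0) -{1}(mulr0 n.+1%:R).
by apply: cvgB; [apply: cvgM => //; exact: cvg_cst|exact: gamma_fun_cvg0].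
Qed.

Lemma continuous_gamma_fun n : continuous (gamma_fun n).
Proof.
move=> y; apply: cvgM; first exact: exprn_continuous.
by apply: continuous_comp; [exact: continuousN|exact: continuous_expR].
Qed.

Lemma integral_gamma_fun n :
  (\int[mu]_(y in halfline) (gamma_fun n y)%:E)%E = n`!%:R%:E.
Proof.
(* The primitive tends to 0 at infinity and equals -n! at 0. *)
rewrite (@ge0_continuous_FTC2y _ _ (gamma_primitive n) _ 0).
- by rewrite gamma_primitive0 EFinN oppeK add0e.
- exact: gamma_fun_ge0.
- by apply: continuous_subspaceT; exact: continuous_gamma_fun.
- exact: gamma_primitive_cvg0.
- by move=> y _; have [] := is_derive_gamma_primitive n y.
- apply: cvg_at_right_filter; apply: differentiable_continuous.
  by apply/derivable1_diffP; have [] := is_derive_gamma_primitive n 0.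
- by move=> y _; rewrite derive1E; have [] := is_derive_gamma_primitive n y.
Qed.

Lemma integrable_gamma_fun n : mu.-integrable halfline (EFin \o gamma_fun n).
Proof.
apply/integrableP; split.
  apply/measurable_EFinP; apply: measurable_funTS.
  by apply: continuous_measurable_fun; exact: continuous_gamma_fun.
(* By nonnegativity on the half-line, the integral of the absolute value is again n!, hence
   finite. *)
suff -> : (\int[mu]_(y in halfline) `|(EFin \o gamma_fun n) y|)%E = n`!%:R%:E.
  exact: ltry.
rewrite -integral_gamma_fun.
apply: eq_integral => y; rewrite inE /= in_itv /= andbT => y_ge0.
by rewrite ger0_norm ?gamma_fun_ge0.
Qed.

End GammaIntegral.

(** * Linearity of the componentwise complex integral *)

Section ComplexIntegral.
Variables (K : realType) (D : set K).
Hypothesis mD : measurable (D : set (measurableTypeR K)).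
Implicit Types (f g : K -> K[i]).

Lemma cintegralD f g : cintegrable D f -> cintegrable D g ->
  cintegrable D (fun y => f y + g y) /\
  cintegral D (fun y => f y + g y) = cintegral D f + cintegral D g.
Proof.
have ReD (z w : K[i]) : complex.Re (z + w) = complex.Re z + complex.Re w.
  by case: z w => [? ?] [].
have ImD (z w : K[i]) : complex.Im (z + w) = complex.Im z + complex.Im w.
  by case: z w => [? ?] [].
move=> [fr fi] [gr gi]; rewrite /cintegrable /cintegral.
under [X in integrable _ _ X /\ _]eq_fun do rewrite ReD EFinD.
under [X in _ /\ integrable _ _ X]eq_fun do rewrite ImD EFinD.
split; first by split; exact: integrableD.
apply/eqP; rewrite eq_complex ReD ImD /=; apply/andP; split; apply/eqP.
  by under eq_Rintegral do rewrite ReD; exact: RintegralD.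
by under eq_Rintegral do rewrite ImD; exact: RintegralD.
Qed.

(** On real values, multiplication by c acts as Re c and Im c on the two components, so real
    linearity applies to each. The terms of the expanded [h_integrand] have this form. *)
Lemma cintegralZ_real (c : K[i]) (g : K -> K) :
  integrable (@lebesgue_measure K) D (EFin \o g) ->
  cintegrable D (fun y => c * real_complex K (g y)) /\
  cintegral D (fun y => c * real_complex K (g y)) =
    c * real_complex K (Rintegral (@lebesgue_measure K) D g).
Proof.
have ReZ (r : K) : complex.Re (c * real_complex K r) = complex.Re c * r.
  by case: c => a b /=; rewrite mulr0 subr0.
have ImZ (r : K) : complex.Im (c * real_complex K r) = complex.Im c * r.
  by case: c ReZ => a b _ /=; rewrite mulr0 add0r.
move=> gint; split.
  split.
    apply: eq_integrable (integrableZl mD (complex.Re c) gint) => // y _.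
    exact: congr1 (esym (ReZ (g y))).
  apply: eq_integrable (integrableZl mD (complex.Im c) gint) => // y _.
  exact: congr1 (esym (ImZ (g y))).
apply/eqP; rewrite eq_complex ReZ ImZ /=; apply/andP; split; apply/eqP.
  by rewrite -(RintegralZl _ mD gint); apply: eq_Rintegral => y _; exact: ReZ.
by rewrite -(RintegralZl _ mD gint); apply: eq_Rintegral => y _; exact: ImZ.
Qed.

Lemma cintegral_sum (I : Type) (r : seq I) (F : I -> K -> K[i]) :
  (forall i, cintegrable D (F i)) ->
  cintegrable D (fun y => \sum_(i <- r) F i y) /\
  cintegral D (fun y => \sum_(i <- r) F i y) = \sum_(i <- r) cintegral D (F i).
Proof.
move=> Fint; elim: r => [|i r [IHint IHeq]].
  have int0 : integrable (@lebesgue_measure K) D (EFin \o (fun=> 0 : K)).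
    exact: integrable0.
  (* The empty sum is put in the form covered by [cintegralZ_real]. *)
  have -> : (fun y => \sum_(i <- [::]) F i y) = (fun y => 0 * real_complex K 0).
    by apply/funext => y; rewrite big_nil mul0r.
  have [int0c eq0c] := cintegralZ_real 0 int0.
  by split; [exact: int0c|rewrite eq0c big_nil mul0r].
have [Dint Deq] := cintegralD (Fint i) IHint.
have -> : (fun y => \sum_(j <- i :: r) F j y) =
          (fun y => F i y + \sum_(j <- r) F j y).
  by apply/funext => y; rewrite big_cons.
by rewrite big_cons -IHeq.
Qed.

End ComplexIntegral.

(** * The integral form of h: binomial expansion, then termwise integration *)

Section HInt.
Variables (K : realType) (a b : nat) (s t : K[i]).

Lemma h_integrand_sum :
  h_integrand a b s t = fun y => \sum_(0 <= j < a.+1)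
    'C(a, j)%:R * s ^+ (a - j) * t ^+ (b + j) * real_complex K (gamma_fun (b + j) y).
Proof.
apply/funext => y; rewrite /h_integrand exprDn !mulr_suml big_mkord.
apply: eq_bigr => j _; rewrite /gamma_fun rmorphM rmorphXn /= -mulr_natl.
rewrite !exprMn !exprD; ring.
Qed.

Lemma h_integrand_integral :
  cintegrable `[0, +oo[%classic (h_integrand a b s t) /\
  h_int a b s t = h a b s t.
Proof.
have mD : measurable (`[0, +oo[%classic : set K) by exact: measurable_itv.
have term_int j := cintegralZ_real mD ('C(a, j)%:R * s ^+ (a - j) * t ^+ (b + j))
  (integrable_gamma_fun K (b + j)).
have [Sint Seq] := cintegral_sum mD (index_iota 0 a.+1) (fun j => (term_int j).1).
rewrite /h_int h_integrand_sum; split; first exact: Sint.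
rewrite Seq /h; apply: eq_bigr => j _.
rewrite (term_int j).2 /Rintegral integral_gamma_fun /= rmorph_nat natrM; ring.
Qed.

End HInt.

Theorem theorem5p3 (n l : nat) (hl : (l <= n)%N) :
  (* arbitrary scalars or indeterminates *)
  (forall (A : comPzRingType) (s t : A),
    [/\ P n l s t = h (n - l) l s t,
        h (n - l) l s t =
          \sum_(l <= j < n.+1)
            ('C(n - l, n - j) * j`!)%:R * s ^+ (n - j) * t ^+ j,
        P n l s t =
          \sum_(0 <= j < l.+1)
            'C(l, j)%:R * (-1) ^+ j * s ^+ j * P (n - j) 0 s t
      & s ^+ n =
          \sum_(0 <= k < n.+1) 'C(n, k)%:R * (-1) ^+ k * P n k s t])
  /\
  (* the integral form of h, for complex (in particular real) scalars *)
  (forall (K : realType) (s t : K[i]),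
    [/\ cintegrable `[0, +oo[%classic (h_integrand (n - l) l s t),
        P n l s t = h_int (n - l) l s t
      & h_int (n - l) l s t = h (n - l) l s t]).
Proof.
split=> [A s t|K s t].
  split; first exact: P_h.
  - exact: h_shifted.
  - exact: P_inclusion_exclusion.
  - exact: expr_sum_P.
have [hint heq] := h_integrand_integral (n - l) l s t.
by split; rewrite // P_h // heq.
Qed.
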